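(* Let $A$ and $B$ be limit aperiodic groups. Then the free product $G=A\star B$ is a limit aperiodic group.
   Context: For a group $G$ (not necessarily finitely generated) and a finite set $F$ with the discrete topology, $F^G$ denotes the set of all maps $G\to F$ with the product topology, and $G$ acts on $F^G$ by $(g\ast f)(a)=f(g^{-1}a)$. A map $\phi\in F^G$ is aperiodic if $b\ast\phi=\phi$ (with $b\in G$) implies $b=e$. A map $f\in F^G$ is limit aperiodic if every $\phi$ in the closure $\overline{\mathrm{Orb}_G(f)}$ of its $G$-orbit in $F^G$ is aperiodic. A group $G$ is limit aperiodic if there exist a finite set $F$ and a limit aperiodic map $f:G\to F$. *)

(* Defs.v *)
From HB Require Import structures.
From mathcomp Require Import all_boot.
From mathcomp Require Import boolp classical_sets functions topology.

Set Implicit Arguments.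
Unset Strict Implicit.
Unset Printing Implicit Defensive.

Local Open Scope classical_set_scope.
Local Open Scope quotient_scope.
Local Open Scope group_scope.

(* F^G with the product topology, F being discrete. *)
Definition full_shift (G : groupType) (F : finType) : topologicalType :=
  {ptws G -> discrete_topology F}.

Definition shift_act (G : groupType) (F : finType) (g : G)
  (f : full_shift G F) : full_shift G F := fun a => f (g^-1 * a).

Definition shift_orbit (G : groupType) (F : finType) (f : full_shift G F) :
  set (full_shift G F) := range (fun g : G => shift_act g f).

Definition aperiodic (G : groupType) (F : finType) (phi : full_shift G F) :=
  forall b : G, shift_act b phi = phi -> b = 1.

Definition limit_aperiodic_map (G : groupType) (F : finType)
  (f : full_shift G F) :=
  forall phi : full_shift G F, closure (shift_orbit f) phi -> aperiodic phi.

Definition limit_aperiodic (G : groupType) :=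
  exists (F : finType) (f : full_shift G F), limit_aperiodic_map f.

(* The free product of A and B is the set of words in the disjoint union of
   A and B, modulo the congruence generated by deleting a letter 1 and by
   multiplying two adjacent letters of the same factor. *)
Section FreeProduct.
Variables A B : groupType.

Definition fp_word := seq (A + B).

Inductive fp_rel : fp_word -> fp_word -> Prop :=
| fp_unit_l u v : fp_rel (u ++ inl 1 :: v) (u ++ v)
| fp_unit_r u v : fp_rel (u ++ inr 1 :: v) (u ++ v)
| fp_mul_l u v a a' : fp_rel (u ++ [:: inl a, inl a' & v])
                             (u ++ inl (a * a') :: v)
| fp_mul_r u v b b' : fp_rel (u ++ [:: inr b, inr b' & v])
                             (u ++ inr (b * b') :: v)
| fp_refl u : fp_rel u u
| fp_sym u v : fp_rel u v -> fp_rel v u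
| fp_trans u v w : fp_rel u v -> fp_rel v w -> fp_rel u w.

Definition fp_relb : rel fp_word := fun u v => `[< fp_rel u v >].

Lemma fp_relb_equiv : equiv_class_of fp_relb.
Proof.
split=> [u|u v|v u w].
- by apply/asboolP; apply: fp_refl.
- by apply/asboolP/asboolP; apply: fp_sym.
- by move=> /asboolP uv /asboolP vw; apply/asboolP; apply: fp_trans uv vw.
Qed.

Canonical fp_equiv := EquivRelPack fp_relb_equiv.

Definition free_product := {eq_quot fp_equiv}.

HB.instance Definition _ := Choice.on free_product.
HB.instance Definition _ := EqQuotient.on free_product.

Lemma fp_piP (u v : fp_word) : \pi_free_product u = \pi v <-> fp_rel u v.
Proof. by split=> [/eqmodP/asboolP|uv]; last by apply/eqmodP/asboolP. Qed.

Lemma fp_rel_catl w u v : fp_rel u v -> fp_rel (w ++ u) (w ++ v).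
Proof.
elim=> {u v} [u v|u v|u v a a'|u v b b'|u|u v _|u v x _ uv _].
- rewrite !catA; exact: fp_unit_l.
- rewrite !catA; exact: fp_unit_r.
- rewrite !catA; exact: fp_mul_l.
- rewrite !catA; exact: fp_mul_r.
- exact: fp_refl.
- exact: fp_sym.
- exact: fp_trans.
Qed.

Lemma fp_rel_catr w u v : fp_rel u v -> fp_rel (u ++ w) (v ++ w).
Proof.
elim=> {u v} [u v|u v|u v a a'|u v b b'|u|u v _|u v x _ uv _];
  rewrite -?catA ?cat_cons.
- exact: fp_unit_l.
- exact: fp_unit_r.
- exact: fp_mul_l.
- exact: fp_mul_r.
- exact: fp_refl.
- exact: fp_sym.
- exact: fp_trans.
Qed.

Definition fp_letter_inv (x : A + B) : A + B :=
  match x with inl a => inl a^-1 | inr b => inr b^-1 end.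

Definition fp_word_inv (u : fp_word) : fp_word := rev (map fp_letter_inv u).

Lemma fp_word_inv_cat u v :
  fp_word_inv (u ++ v) = fp_word_inv v ++ fp_word_inv u.
Proof. by rewrite /fp_word_inv map_cat rev_cat. Qed.

Lemma fp_word_inv_cons x u :
  fp_word_inv (x :: u) = fp_word_inv u ++ [:: fp_letter_inv x].
Proof. by rewrite /fp_word_inv /= rev_cons cats1. Qed.

Lemma fp_rel_inv u v : fp_rel u v -> fp_rel (fp_word_inv u) (fp_word_inv v).
Proof.
elim=> {u v} [u v|u v|u v a a'|u v b b'|u|u v _|u v x _ uv _];
  rewrite ?fp_word_inv_cat ?fp_word_inv_cons /= -?catA ?invg1 ?invgM /=.
- exact: fp_unit_l.
- exact: fp_unit_r.
- exact: fp_mul_l.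
- exact: fp_mul_r.
- exact: fp_refl.
- exact: fp_sym.
- exact: fp_trans.
Qed.

Lemma fp_rel_letterV x : fp_rel [:: x; fp_letter_inv x] [::].
Proof.
case: x => [a|b] /=.
- apply: fp_trans (fp_mul_l [::] [::] _ _) _; rewrite mulgV.
  exact: (fp_unit_l [::] [::]).
- apply: fp_trans (fp_mul_r [::] [::] _ _) _; rewrite mulgV.
  exact: (fp_unit_r [::] [::]).
Qed.

Lemma fp_rel_mulV u : fp_rel (u ++ fp_word_inv u) [::].
Proof.
elim: u => [|x u IH]; first exact: fp_refl.
rewrite fp_word_inv_cons -cat1s -!catA (catA u).
apply: fp_trans (fp_rel_letterV x); apply: (fp_rel_catl [:: x]).
exact: (fp_rel_catr [:: _] IH).
Qed.

Lemma fp_word_invK : involutive fp_word_inv.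
Proof.
by move=> u; rewrite /fp_word_inv map_rev revK mapK // => -[a|b] /=;
  rewrite invgK.
Qed.

Lemma fp_rel_mulVg u : fp_rel (fp_word_inv u ++ u) [::].
Proof. by rewrite -[X in _ ++ X]fp_word_invK; exact: fp_rel_mulV. Qed.

Definition fp_one : free_product := \pi_free_product [::].
Definition fp_mul (x y : free_product) : free_product :=
  \pi_free_product (repr x ++ repr y).
Definition fp_inv (x : free_product) : free_product :=
  \pi_free_product (fp_word_inv (repr x)).

Lemma fp_repr_pi u : fp_rel (repr (\pi_free_product u)) u.
Proof. by apply/fp_piP; rewrite reprK. Qed.

Lemma fp_mul_pi u v : fp_mul (\pi u) (\pi v) = \pi_free_product (u ++ v).
Proof.
apply/fp_piP; apply: fp_trans (fp_rel_catl _ (fp_repr_pi v)).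
exact: fp_rel_catr (fp_repr_pi u).
Qed.

Lemma fp_inv_pi u : fp_inv (\pi u) = \pi_free_product (fp_word_inv u).
Proof. by apply/fp_piP/fp_rel_inv/fp_repr_pi. Qed.

Lemma fp_mulA : associative fp_mul.
Proof.
by elim/quotW=> u; elim/quotW=> v; elim/quotW=> w; rewrite !fp_mul_pi catA.
Qed.

Lemma fp_mul1 : left_id fp_one fp_mul.
Proof. by elim/quotW=> u; rewrite fp_mul_pi. Qed.

Lemma fp_mulr1 : right_id fp_one fp_mul.
Proof. by elim/quotW=> u; rewrite fp_mul_pi cats0. Qed.

Lemma fp_mulV : left_inverse fp_one fp_inv fp_mul.
Proof.
by elim/quotW=> u; rewrite fp_inv_pi fp_mul_pi; apply/fp_piP/fp_rel_mulVg.
Qed.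

Lemma fp_mulgV : right_inverse fp_one fp_inv fp_mul.
Proof.
by elim/quotW=> u; rewrite fp_inv_pi fp_mul_pi; apply/fp_piP/fp_rel_mulV.
Qed.

HB.instance Definition _ :=
  isGroup.Build free_product fp_mulA fp_mul1 fp_mulr1 fp_mulV fp_mulgV.

Definition fp_inl (a : A) : free_product := \pi_free_product [:: inl a].
Definition fp_inr (b : B) : free_product := \pi_free_product [:: inr b].

Lemma fp_inl_morphism : monoid_morphism fp_inl.
Proof.
split; first by apply/fp_piP; exact: (fp_unit_l [::] [::]).
move=> a a'; rewrite [RHS]fp_mul_pi; apply/fp_piP; apply: fp_sym.
exact: (fp_mul_l [::] [::]).
Qed.

Lemma fp_inr_morphism : monoid_morphism fp_inr.
Proof.
split; first by apply/fp_piP; exact: (fp_unit_r [::] [::]).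
move=> b b'; rewrite [RHS]fp_mul_pi; apply/fp_piP; apply: fp_sym.
exact: (fp_mul_r [::] [::]).
Qed.

End FreeProduct.

Theorem free_product_universal (A B H : groupType) (f : A -> H) (g : B -> H) :
  monoid_morphism f -> monoid_morphism g ->
  exists! h : free_product A B -> H,
    [/\ monoid_morphism h,
        forall a, h (fp_inl B a) = f a & forall b, h (fp_inr A b) = g b].
Proof.
move=> [f1 fM] [g1 gM].
pose e (x : A + B) := match x with inl a => f a | inr b => g b end.
pose ev (u : fp_word A B) : H := foldr (fun x y => e x * y) 1 u.
have ev_cat u v : ev (u ++ v) = ev u * ev v.
  by elim: u => [|x u IH] /=; rewrite ?mul1g // IH mulgA.
have ev_rel u v : fp_rel u v -> ev u = ev v.
  elim=> {u v} [u v|u v|u v a a'|u v b b'|//|u v _ -> //|u v w _ -> _ -> //];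
    by rewrite !ev_cat /= ?f1 ?g1 ?fM ?gM ?mul1g ?mulgA.
pose h (x : free_product A B) := ev (repr x).
have h_pi u : h (\pi u) = ev u by apply/ev_rel/fp_repr_pi.
have hM : {morph h : x y / x * y}.
  by elim/quotW=> u; elim/quotW=> v; rewrite [u in h u]fp_mul_pi !h_pi ev_cat.
exists h; split=> [|k [[k1 kM] kl kr]].
  split=> [|a|b]; [|by rewrite h_pi /= mulg1..].
  by split=> //; rewrite [LHS]h_pi.
apply/funext; elim/quotW; elim=> [|x u IH]; first by rewrite h_pi [RHS]k1.
have -> : \pi_(free_product A B) (x :: u)
        = (\pi_(free_product A B) [:: x] : free_product A B) * \pi u.
  by rewrite [RHS]fp_mul_pi.
by rewrite hM kM IH; congr (_ * _); case: x => [a|b];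
  rewrite h_pi /= mulg1 -?kl -?kr.
Qed.

(* Main.v *)
(** By compactness, [f] is limit aperiodic iff for every [b != 1] there is a
    finite [S] such that no [g] has [f (g s) = f (g b s)] for all [s] in [S].
    This property of [b] depends only on the conjugacy class of [b].

    Given limit aperiodic [fA] and [fB], colour a reduced word [g] by [fA] of its
    last letter if that letter is in [A] (else [fA 1]), by [fB] likewise, and by
    the parity of the 2-adic valuation of [|g| + 1]. Multiplying [g] on the right
    by [A] translates its [A]-part, so [fA] breaks the conjugates of elements of
    [A], and [fB] those of [B]. Any other [b != 1] is conjugate to a cyclically
    reduced word [c] of length at least 2. For each [g] there is no cancellation
    in [g c^n], or else none in [g c^-n]; so word lengths grow by one along that
    ray, while the 2-adic parity sequence has no long periodic stretch. *)

Require Import Defs.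
From mathcomp Require Import monoid.
From mathcomp Require Import all_boot zify.
From mathcomp Require Import boolp classical_sets cardinality topology.

Set Implicit Arguments.
Unset Strict Implicit.
Unset Printing Implicit Defensive.

(** * Parity of the 2-adic valuation *)

Definition ruler_parity (n : nat) : bool := odd (logn 2 n).

(** Induction on [p]: an odd [p] is settled modulo 4, and an even one is halved by looking at even
    positions only, where [ruler_parity] is the negation of its value at half the position. *)
Lemma ruler_parity_aperiodic p : 0 < p ->
  exists L, forall n, 0 < n ->
    exists2 i, i < L & ruler_parity (n + i) != ruler_parity (n + i + p).
Proof.
have rodd n : odd n -> ruler_parity n = false.
  by move=> on; rewrite /ruler_parity lognE /= dvdn2 on andbF.
have rdbl n : 0 < n -> ruler_parity n.*2 = ~~ ruler_parity n.
  by move=> n0; rewrite /ruler_parity -muln2 lognM // addn1.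
elim/ltn_ind: p => p IH p0; case: (boolP (odd p)) => op.
  exists 4 => n n0; pose m := n + p.
  (* As [p] is odd, taking [n + i + p] congruent to 2 modulo 4 makes [n + i] odd; the valuations are
     then 1 and 0. *)
  have [i [i4 oi [k ek]]] : exists i, [/\ i < 4, odd (n + i) & exists k, n + i + p = (k.*2.+1).*2].
    have : m %% 4 < 4 by rewrite ltn_mod.
    have em := divn_eq m 4.
    case: (m %% 4) em => [|[|[|[|//]]]] em _.
    - exists 2; split=> //; first by lia. exists (m %/ 4); lia.
    - exists 1; split=> //; first by lia. exists (m %/ 4); lia.
    - exists 0; split=> //; first by lia. exists (m %/ 4); lia.
    - exists 3; split=> //; first by lia. exists (m %/ 4).+1; lia.
  by exists i => //; rewrite ek rdbl // !rodd //= odd_double.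
have ep : p = p./2.*2 by lia.
have [||L HL] := IH p./2; [lia|lia|].
(* Rounding half of [n] up keeps the doubled position at least [n]. *)
exists L.*2.+1 => n n0; have [|i iL ne] := HL (n.+1./2); first lia.
exists ((n.+1./2 + i).*2 - n); first lia.
rewrite subnKC; last lia.
have -> : (n.+1./2 + i).*2 + p = (n.+1./2 + i + p./2).*2 by lia.
rewrite !rdbl ?(inj_eq negb_inj) //; lia.
Qed.

Local Open Scope classical_set_scope.
Local Open Scope group_scope.

(** * A finite criterion for limit aperiodicity *)

Definition uniformly_breaks (G : groupType) (F : eqType) (f : G -> F) (b : G) :=
  exists S : seq G, forall g : G, exists2 s, s \in S & f (g * s) != f (g * b * s).

Lemma nbhs_cylinder (G : groupType) (F : finType) (S : seq G)
  (phi : full_shift G F) :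
  nbhs phi [set psi : full_shift G F | {in S, psi =1 phi}].
Proof.
elim: S => [|s S IH]; first by apply: filterS filterT => psi _ s.
have Ns : nbhs phi [set psi : full_shift G F | psi s = phi s].
  exact: (@proj_continuous G (fun=> discrete_topology F) s phi [set phi s]
    (discrete_set1 _)).
apply: filterS (filterI Ns IH) => psi [/= es eS] x.
by rewrite inE => /predU1P[->//|/eS].
Qed.

(** If no finite [S] works for [b], the sets [K S] of translates of [f] that look [b]-periodic on
    [S] form a filter base. By Tychonoff it has a cluster point, which lies in the orbit closure and
    is fixed by [b]. *)
Lemma limit_aperiodic_mapP (G : groupType) (F : finType) (f : full_shift G F) :
  limit_aperiodic_map f <-> forall b : G, b != 1 -> uniformly_breaks f b.
Proof.
split=> [fap b b1|fbr phi fphi b phib].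
- apply/not_existsP => nS; move/eqP: b1; apply.
  pose K (S : seq G) : set (full_shift G F) := (fun g => shift_act g^-1 f) @`
    [set g | {in S, forall s, f (g * s) = f (g * b * s)}].
  have FK : Filter (filter_from setT K).
    apply: filter_from_filter; first by exists [::].
    move=> S T _ _; exists (S ++ T) => // _ [g gST <-].
    by split; exists g => // s sS; apply: gST; rewrite mem_cat sS ?orbT.
  have PFK : ProperFilter (filter_from setT K).
    apply: filter_from_proper => S _; apply/set0P/eqP => KS0; apply: (nS S) => g.
    apply: contrapT => ng; have : K S (shift_act g^-1 f); last by rewrite KS0.
    exists g => // s sS; apply/eqP/negPn/negP => gs.
    by apply: ng; exists s.
  have Kphi : compact [set h : full_shift G F | forall i, [set: discrete_topology F] (h i)].
    by apply: (@tychonoff G (fun=> discrete_topology F) (fun=> setT)) => _;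
      apply: finite_compact; apply: (@finite_finset F).
  have [|phi [_ clphi]] := Kphi _ PFK.
    by exists [::].
  apply: (fap phi) => [U Uphi|].
    have [|psi [[g _ gpsi] Upsi]] := clphi (K [::]) U _ Uphi; first by exists [::].
    by exists psi; split=> //; exists g^-1.
  apply/funext => a; rewrite /shift_act.
  set S := [:: b^-1 * a; a].
  have [|_ [[g gS <-] gphi]] := clphi (K S) _ _ (nbhs_cylinder S phi).
    by exists S.
  have := gS (b^-1 * a); rewrite inE eqxx => /(_ isT).
  have := gphi (b^-1 * a); rewrite inE eqxx /shift_act invgK => /(_ isT) <-.
  have := gphi a; rewrite !inE eqxx orbT /shift_act invgK => /(_ isT) <-.
  by rewrite -mulgA mulVKg.
- apply: contrapT => /eqP b1; have [S fS] := fbr b b1.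
  (* The cylinder covers [S] and its translate by [b], so a single translate of [f] gives both
     values compared below. *)
  have [_ [[g _ <-] gphi]] := fphi _ (nbhs_cylinder (S ++ map (fun s => b * s) S) phi).
  have [s sS] := fS g^-1; rewrite -mulgA.
  have -> : f (g^-1 * s) = phi s by apply: gphi; rewrite mem_cat sS.
  have -> : f (g^-1 * (b * s)) = phi (b * s).
    by apply: gphi; rewrite mem_cat map_f ?orbT.
  have /(congr1 (@^~ (b * s))) := phib.
  by rewrite {1}/shift_act mulKg => ->; rewrite eqxx.
Qed.

Lemma uniformly_breaks_conj (G : groupType) (F : eqType) (f : G -> F) (b h : G) :
  uniformly_breaks f b -> uniformly_breaks f (h * b * h^-1).
Proof.
case=> S fS; exists (map (fun s => h * s) S) => g; have [s sS fs] := fS (g * h).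
by exists (h * s); rewrite ?map_f // !mulgA mulgVK.
Qed.


(** Rotating a word conjugates the element it represents; here the rotation brings a bad pair to the
    front, where two letters of one factor can be merged. *)
Lemma cycleNP (T : Type) (e : rel T) (s : seq T) : 1%N < size s -> ~~ cycle e s ->
  exists u v x y w, [/\ s = u ++ v, v ++ u = [:: x, y & w] & ~~ e x y].
Proof.
case: s => // x p sp; rewrite /cycle rcons_path negb_and => /orP[npath|nlast].
  suff [u [a [b [w [-> nab]]]]] : exists u a b w,
      x :: p = u ++ [:: a, b & w] /\ ~~ e a b.
    by exists u, [:: a, b & w], a, b, (w ++ u).
  elim: p x npath {sp} => //= y p IH x; rewrite negb_and => /orP[nxy|/IH].
    by exists [::], x, y, p.
  by case=> u [a [b [w [-> nab]]]]; exists (x :: u), a, b, w.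
case: (lastP p) sp nlast => // q l _; rewrite last_rcons => nlx.
by exists (x :: q), [:: l], l, x, q; rewrite -cats1.
Qed.

(** * Normal forms in the free product *)

Section NormalForm.
Variables A B : groupType.
Implicit Types (x y : A + B) (u v w c : fp_word A B) (g : free_product A B).

Local Notation pi u := (\pi_(free_product A B)%qT u : free_product A B).

Definition from_left x : bool := if x is inl _ then true else false.

Definition alternate x y : bool := from_left x != from_left y.

Definition trivial_letter x : bool :=
  match x with inl a => a == 1 | inr b => b == 1 end.

(* Meaningful only when [x] and [y] come from the same factor. *)
Definition letter_mul x y : A + B :=
  match x, y with
  | inl a, inl a' => inl (a * a')
  | inr b, inr b' => inr (b * b')
  | _, _ => x
  end.

Definition letter_one x : A + B :=
  match x with inl _ => inl 1 | inr _ => inr 1 end.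

Definition clear w x : bool := if w is y :: _ then alternate y x else true.

(* Words are read as stacks, the head being the last letter of the element of
   the free product that the word represents. *)
Fixpoint reduced w : bool :=
  if w is x :: w' then [&& ~~ trivial_letter x, clear w' x & reduced w']
  else true.

(* Splits off the maximal suffix of [w] in the factor of [x], as a letter that
   is trivial if this suffix is empty. *)
Definition pop x w : (A + B) * fp_word A B :=
  if w is y :: w' then if alternate y x then (letter_one x, w) else (y, w')
  else (letter_one x, w).

Definition place x w : fp_word A B := if trivial_letter x then w else x :: w.

Definition push w x : fp_word A B :=
  place (letter_mul (pop x w).1 x) (pop x w).2.

Lemma letter_mulA x y z : ~~ alternate x y -> ~~ alternate y z ->
  letter_mul x (letter_mul y z) = letter_mul (letter_mul x y) z.
Proof. by case: x y z => [x|x] [y|y] [z|z] //= _ _; rewrite mulgA. Qed.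

Lemma popP x w : reduced w ->
  [/\ ~~ alternate (pop x w).1 x, clear (pop x w).2 x, reduced (pop x w).2
    & place (pop x w).1 (pop x w).2 = w].
Proof.
rewrite /place; case: w => [|y w] /=; first by case: x => /= ?; rewrite eqxx.
case: ifPn => /= [ayx|nayx] /and3P[ty cwy rw].
  by rewrite ayx ty cwy rw; case: x ayx => /= ?; rewrite eqxx.
rewrite (negPf ty); split=> //; case: w cwy {rw} => //= z w.
by case: x y z nayx {ty} => [?|?] [?|?] [?|?].
Qed.

Lemma pop_place x y w : ~~ alternate y x -> clear w x ->
  pop x (place y w) = (y, w).
Proof.
rewrite /place; case: ifPn => [ty|nty] nayx cwx; last by rewrite /= (negPf nayx).
have -> : y = letter_one x.
  by case: x y nayx ty {cwx} => [x|x] [y|y] //= _ /eqP->.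
by case: w cwx => //= z w ->.
Qed.

Lemma pop_letter_mul x y w : pop (letter_mul x y) w = pop x w.
Proof. by case: x y => [x|x] [y|y]; case: w => [|[z|z] w]. Qed.

Lemma alternate_mul x y z : alternate (letter_mul x y) z = alternate x z.
Proof. by case: x y z => [x|x] [y|y] [z|z]. Qed.

Lemma clear_mul x y w : clear w (letter_mul x y) = clear w x.
Proof. by case: x y w => [x|x] [y|y] [|[z|z] w]. Qed.

Lemma clear_side x y w : ~~ alternate x y -> clear w x = clear w y.
Proof. by case: x y w => [x|x] [y|y] [|[z|z] w]. Qed.

Lemma push_reduced w x : reduced w -> reduced (push w x).
Proof.
move=> /(popP x)[nax cx rw _]; rewrite /push /place; case: ifPn => //= ->.
by rewrite clear_mul (clear_side _ nax) cx.
Qed.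

Lemma pop_push w x : reduced w ->
  pop x (push w x) = (letter_mul (pop x w).1 x, (pop x w).2).
Proof. by case/(popP x)=> nax cx _ _; rewrite pop_place ?alternate_mul. Qed.

Lemma push_push w x y : reduced w -> ~~ alternate x y ->
  push (push w x) y = push w (letter_mul x y).
Proof.
move=> rw nxy; rewrite {1}/push.
have -> : pop y (push w x) = pop x (push w x).
  by case: x y nxy => [x|x] [y|y] // _; case: (push w _) => [|[z|z] ?].
by case: (popP x rw) => nax _ _ _; rewrite pop_push //= /push pop_letter_mul letter_mulA.
Qed.

Lemma push_trivial w x : reduced w -> trivial_letter x -> push w x = w.
Proof.
move=> /(popP x)[nax _ _ ew] tx; rewrite -[RHS]ew /push; congr place.
by case: x (pop x w).1 tx nax {ew} => [x|x] [y|y] //= /eqP-> _; rewrite mulg1.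
Qed.

Lemma push_clear w x : clear w x -> ~~ trivial_letter x -> push w x = x :: w.
Proof.
move=> cwx tx; have -> : push w x = place (letter_mul (letter_one x) x) w.
  by rewrite /push; case: w cwx => //= y w ->.
by case: x tx {cwx} => x tx; rewrite /= mul1g /place (negPf tx).
Qed.

Lemma pushes_reduced w u : reduced w -> reduced (foldl push w u).
Proof. by elim: u w => //= x u IH w /(push_reduced x)/IH. Qed.

(** Van der Waerden's trick: letters act on reduced words from the right, compatibly with the
    defining relations, so the effect of a word depends only on the element it represents. *)
Lemma pushes_rel u v w : fp_rel u v -> reduced w ->
  foldl push w u = foldl push w v.
Proof.
move=> uv; elim: uv w => {u v}
  [u v|u v|u v a a'|u v b b'|//|u v _ IH|u v x _ IH1 _ IH2] w rw.
- by rewrite !foldl_cat /= push_trivial ?pushes_reduced //= eqxx.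
- by rewrite !foldl_cat /= push_trivial ?pushes_reduced //= eqxx.
- by rewrite !foldl_cat /= push_push ?pushes_reduced.
- by rewrite !foldl_cat /= push_push ?pushes_reduced.
- by rewrite IH.
- by rewrite IH1 // IH2.
Qed.

Definition nf g : fp_word A B := foldl push [::] (repr g).

Lemma nf_reduced g : reduced (nf g). Proof. exact: pushes_reduced. Qed.

Lemma pi_cat u v : pi (u ++ v) = pi u * pi v.
Proof. by rewrite [RHS]fp_mul_pi. Qed.

Lemma nf_mul_pi g u : nf (g * pi u) = foldl push (nf g) u.
Proof.
rewrite -{1}[g]reprK -pi_cat -foldl_cat; apply: pushes_rel => //.
exact: fp_repr_pi.
Qed.

Definition left_part w : A := if (pop (inl 1) w).1 is inl a then a else 1.
Definition right_part w : B := if (pop (inr 1) w).1 is inr b then b else 1.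

Lemma left_part_push w a : reduced w ->
  left_part (push w (inl a)) = left_part w * a.
Proof.
move=> rw; rewrite /left_part.
have e w' : pop (inl 1) w' = pop (inl a) w' by case: w' => [|[z|z] ?].
by rewrite !e pop_push //; case: (popP (inl a) rw); case: (pop _ _) => -[].
Qed.

Lemma right_part_push w b : reduced w ->
  right_part (push w (inr b)) = right_part w * b.
Proof.
move=> rw; rewrite /right_part.
have e w' : pop (inr 1) w' = pop (inr b) w' by case: w' => [|[z|z] ?].
by rewrite !e pop_push //; case: (popP (inr b) rw); case: (pop _ _) => -[].
Qed.

(* The prefix of length [i] of the infinite word [c c c ...]. *)
Definition power_prefix c i : fp_word A B :=
  mkseq (fun j => nth (inl 1) c (j %% size c)%N) i.

Lemma power_prefixD c i : power_prefix c (size c + i) = c ++ power_prefix c i.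
Proof.
rewrite /power_prefix /mkseq iotaD map_cat; congr (_ ++ _).
  rewrite -[RHS](mkseq_nth (inl 1)); apply/eq_in_map => j.
  by rewrite mem_iota /= add0n => jc; rewrite modn_small.
rewrite -[X in iota X]addn0 iotaDl -map_comp; apply: eq_map => j /=.
by rewrite modnDl.
Qed.

Lemma size_pushes_power_prefix w c i : c != [::] ->
  all (predC trivial_letter) c -> cycle alternate c -> clear w (head (inl 1) c) ->
  size (foldl push w (power_prefix c i)) = (size w + i)%N.
Proof.
move=> c0 tc ac cw; have s0 : 0%N < size c by case: (c) c0.
pose x j := nth (inl 1) c (j %% size c)%N.
have tx j : ~~ trivial_letter (x j) by apply: (all_nthP _ tc); rewrite ltn_mod.
have ax j : alternate (x j) (x j.+1).
  rewrite /x; have := ltn_pmod j s0; rewrite -(addn1 j) -modnDml addn1.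
  move: (j %% size c)%N => k.
  case: (c) ac => // y p /(pathP (inl 1)) pc /= kp.
  (* At the end of a period the index wraps around to the first letter; this pair alternates because
     [c] does so cyclically. *)
  have := pc k; rewrite size_rcons -rcons_cons [nth _ (rcons (y :: p) y) k]nth_rcons.
  rewrite /= kp nth_rcons => /(_ isT); move: kp; rewrite ltnS leq_eqVlt.
  case/predU1P => [->|kp]; first by rewrite ltnn eqxx modnn.
  by rewrite kp modn_small.
(* The induction must also carry that the next letter [x i] merges with nothing. *)
suff : size (foldl push w (power_prefix c i)) = (size w + i)%N /\
  clear (foldl push w (power_prefix c i)) (x i) by case.
elim: i => [|i [IHs IHc]].
  by rewrite addn0 /x mod0n nth0.
have -> : power_prefix c i.+1 = rcons (power_prefix c i) (x i).
  by rewrite /power_prefix mkseqS.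
by rewrite foldl_rcons push_clear //= IHs addnS.
Qed.

(** * The colouring and the elements it breaks *)

Section Colouring.
Variables (FA FB : finType) (fA : A -> FA) (fB : B -> FB).
Hypothesis hA : forall a : A, a != 1 -> uniformly_breaks fA a.
Hypothesis hB : forall b : B, b != 1 -> uniformly_breaks fB b.

(** The successor keeps the argument of [ruler_parity] positive, as [ruler_parity_aperiodic]
    requires. *)
Definition colouring g : FA * FB * bool :=
  (fA (left_part (nf g)), fB (right_part (nf g)), ruler_parity (size (nf g)).+1).

Lemma colouring_breaks_left (a : A) : a != 1 ->
  uniformly_breaks colouring (pi [:: inl a]).
Proof.
case/hA=> S fS; exists (map (@fp_inl A B) S) => g.
have [s sS fs] := fS (left_part (nf g)); exists (fp_inl B s); rewrite ?map_f //.
apply: contraNneq fs => -[+ _ _].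
by rewrite !nf_mul_pi /= !left_part_push ?push_reduced ?nf_reduced // => ->.
Qed.

Lemma colouring_breaks_right (b : B) : b != 1 ->
  uniformly_breaks colouring (pi [:: inr b]).
Proof.
case/hB=> S fS; exists (map (@fp_inr A B) S) => g.
have [s sS fs] := fS (right_part (nf g)); exists (fp_inr A s); rewrite ?map_f //.
apply: contraNneq fs => -[_ + _].
by rewrite !nf_mul_pi /= !right_part_push ?push_reduced ?nf_reduced // => ->.
Qed.

(** Prepending [c] to the prefix of length [i] gives the prefix of length [size c + i], so the two
    word lengths differ by [size c], the period fed to [ruler_parity_aperiodic]. *)
Lemma colouring_changes_along c : c != [::] ->
  all (predC trivial_letter) c -> cycle alternate c ->
  exists L, forall g, clear (nf g) (head (inl 1) c) -> exists2 i, i < L &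
    colouring (g * pi (power_prefix c i)) !=
    colouring (g * pi c * pi (power_prefix c i)).
Proof.
move=> c0 tc ac; have s0 : 0%N < size c by case: (c) c0.
have [L HL] := ruler_parity_aperiodic s0; exists L => g cg.
have [i iL ne] := HL (size (nf g)).+1 isT; exists i => //.
apply: contraNneq ne => -[_ _]; rewrite -mulgA -pi_cat -power_prefixD !nf_mul_pi.
by rewrite !size_pushes_power_prefix // !addSn -addnA [(i + _)%N]addnC => ->.
Qed.

Lemma pi_word_inv c : pi (fp_word_inv c) = (pi c)^-1.
Proof. by rewrite [RHS]fp_inv_pi. Qed.

Lemma colouring_breaks_cyclic c : c != [::] ->
  all (predC trivial_letter) c -> cycle alternate c ->
  uniformly_breaks colouring (pi c).
Proof.
move=> c0 tc ac; pose c' := fp_word_inv c.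
have side_inv x y : alternate (fp_letter_inv x) (fp_letter_inv y) = alternate y x.
  by case: x y => [?|?] [?|?].
have c'0 : c' != [::] by rewrite -size_eq0 size_rev size_map size_eq0.
have tc' : all (predC trivial_letter) c'.
  rewrite all_rev all_map; apply: sub_all tc => -[a|b] /=; by rewrite invg_eq1.
have ac' : cycle alternate c'.
  rewrite /c' /fp_word_inv rev_cycle (mono_cycle (e := alternate)) //.
have [L HL] := colouring_changes_along c0 tc ac.
have [L' HL'] := colouring_changes_along c'0 tc' ac'.
exists (map (fun i => pi (power_prefix c i)) (iota 0 L) ++
  map (fun i => pi c' * pi (power_prefix c' i)) (iota 0 L')) => g.
have [cg|ncg] := boolP (clear (nf g) (head (inl 1) c)).
  have [i iL ne] := HL g cg; exists (pi (power_prefix c i)) => //.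
  by rewrite mem_cat; apply/orP; left; apply: map_f; rewrite mem_iota.
(* The last letter of [g] shares the factor of the first letter of [c]. By cyclic alternation the
   last letter of [c], hence the first of [c'], lies in the other factor. *)
have [|i iL ne] := HL' g.
  move: ac c0 ncg; rewrite /c' /fp_word_inv; case: (lastP c) => // p x.
  rewrite map_rcons rev_rcons /=; case: p => [|y p].
    by rewrite /= /alternate eqxx.
  rewrite rcons_cons /= rcons_path last_rcons => /andP[_ +] _.
  by case: (nf g) => [|[?|?] ?] //; case: x y => [?|?] [?|?].
(* The leading [c'] turns the comparison of [g] with [g c] into that of [g c'] with [g]. *)
exists (pi c' * pi (power_prefix c' i)).
  by rewrite mem_cat; apply/orP; right; apply: (map_f (fun i => _ * _)); rewrite mem_iota.
by rewrite eq_sym mulgA pi_word_inv mulgK -pi_word_inv mulgA.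
Qed.

Lemma pi_cons2 x y w : ~~ alternate x y ->
  pi [:: x, y & w] = pi (letter_mul x y :: w).
Proof.
move=> nxy; apply/fp_piP; case: x y nxy => [x|x] [y|y] //= _.
  exact: (fp_mul_l [::]).
exact: (fp_mul_r [::]).
Qed.

(** Induction on the length of a word for [g]: a trivial letter is deleted, and a longer word that
    fails to alternate cyclically is rotated so that two letters merge. Single letters and
    cyclically alternating words remain. *)
Lemma colouring_breaks g : g != 1 -> uniformly_breaks colouring g.
Proof.
elim/quotW: g => c; move: {2}(size c) (leqnn (size c)) => n.
elim: n c => [|n IH] c; first by rewrite leqn0 size_eq0 => /eqP->; rewrite eqxx.
move=> sc c1; have [tc|] := boolP (all (predC trivial_letter) c); last first.
  case/allPn=> x xc /negPn tx; move: xc sc c1.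
  case/splitPr=> u v; rewrite size_cat addnS ltnS -size_cat => sc.
  have -> : pi (u ++ x :: v) = pi (u ++ v); last exact: IH.
  apply/fp_piP; case: x tx => x /eqP->; [exact: fp_unit_l|exact: fp_unit_r].
have c0 : c != [::] by apply: contraNneq c1 => ->.
have [ac|nac] := boolP (cycle alternate c); first exact: colouring_breaks_cyclic.
have [s1|] := ltnP 1%N (size c); last first.
  case: c tc c0 {sc c1 nac} => [|[a|b] []] //= /andP[x1 _] _ _.
    exact: colouring_breaks_left.
  exact: colouring_breaks_right.
have [u [v [x [y [w [ec evu nxy]]]]]] := cycleNP s1 nac.
have econj : pi c = pi u * pi (v ++ u) * (pi u)^-1.
  by rewrite ec !pi_cat mulgA mulgK.
rewrite econj; apply: uniformly_breaks_conj; rewrite evu pi_cons2 //.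
apply: IH.
  have := congr1 size evu; rewrite size_cat addnC -size_cat -ec => e.
  by move: sc; rewrite e.
by apply: contraNneq c1 => e; rewrite econj evu pi_cons2 // e mulg1 mulgV.
Qed.

End Colouring.
End NormalForm.

Theorem theorem3p11 (A B : groupType) (hA : limit_aperiodic A)
    (hB : limit_aperiodic B) : limit_aperiodic (free_product A B).
Proof.
case: hA hB => [FA [fA /limit_aperiodic_mapP hA]] [FB [fB /limit_aperiodic_mapP hB]].
exists (FA * FB * bool)%type, (colouring fA fB).
by apply/limit_aperiodic_mapP; apply: colouring_breaks.
Qed.
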